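(* The distinct distance constant satisfies $\mathrm{DDC}\le 2.247307$.
   Context: A Sidon set is a set $S$ of positive integers such that all the sums $s+s'$ with $s,s'\in S$, $s\le s'$, are distinct. The distinct distance constant is $\mathrm{DDC}=\sup\{\sum_{s\in S}1/s : S\subset\mathbb{N}^*\text{ is a Sidon set}\}$. *)

(* Defs.v *)
From mathcomp Require Export all_boot all_order all_algebra.
From mathcomp Require Export boolp classical_sets reals ereal esum.

Set Implicit Arguments.
Unset Strict Implicit.
Unset Printing Implicit Defensive.

Import Order.TTheory GRing.Theory Num.Theory.

Local Open Scope classical_set_scope.
Local Open Scope ring_scope.

Definition sidon_set (S : set nat) : Prop :=
  (forall s, S s -> (0 < s)%N) /\
  (forall a b c d : nat, S a -> S b -> S c -> S d ->
     (a <= b)%N -> (c <= d)%N -> (a + b = c + d)%N -> a = c /\ b = d).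

(* [S] may be infinite, and the supremum is not known a priori to be finite:
   both are taken in the extended reals. *)
Definition DDC (R : realType) : \bar R :=
  ereal_sup [set \esum_(s in S) ((s%:R : R)^-1)%:E | S in sidon_set].

(* Main.v *)
From Stdlib Require Import NArith.
Require Import Defs.
From mathcomp Require Import fsbigop cardinality zify ring lra.

Set Implicit Arguments.
Unset Strict Implicit.
Unset Printing Implicit Defensive.

Import Order.TTheory GRing.Theory Num.Theory.

(* A window W (an interval) containing a elements of a Sidon set S satisfies
   m a <= C(a, 2) + C(m+1, 2) for every integer m.  Give the windows weights.
   As the differences of S are distinct, the total weight of the pairs of S
   lying in a common window is at most the sum over d of the largest weight
   that a pair at distance d can have.  Hence every choice of weights bounds a
   linear functional of the indicator function of S.
   - All windows of length about 4.5 sqrt x, with m = 4, show that S has at most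
     1.12 sqrt x + 19/8 elements up to x.  By Abel summation, the sum of 1/s is
     then at most the sum of 1/s - 1/81 over s <= 81, plus
     2.24/9 + 19/(8 * 81) < 0.27822.
   - Weights on 93 windows, found by linear programming, bound the sum of
     1/s - 1/81 over s <= 81 by 1.969. *)

Local Open Scope nat_scope.

(** * Distinct differences and the weighted window inequality *)

Definition distinct_differences (P : pred nat) :=
  forall s s' t t', P s -> P s' -> P t -> P t' ->
    s < s' -> t < t' -> s' - s = t' - t -> s = t /\ s' = t'.

(** Equal differences give [s + t' = s' + t]; the four cases only sort the two summands on each
    side. *)
Lemma sidon_distinct_differences (S : set nat) (P : pred nat) :
  sidon_set S -> (forall s, P s -> S s) -> distinct_differences P.
Proof.
move=> [_ H] PS s s' t t' /PS Ss /PS Ss' /PS St /PS St' lts ltt e.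
have e2 : s + t' = s' + t by lia.
have [st|st] := leqP s t'; have [ts|ts] := leqP t s'.
- by have := H _ _ _ _ Ss St' St Ss' st ts ltac:(lia); lia.
- by have := H _ _ _ _ Ss St' Ss' St st (ltnW ts) ltac:(lia); lia.
- by have := H _ _ _ _ St' Ss St Ss' (ltnW st) ts ltac:(lia); lia.
- lia.
Qed.

(** Twice the difference of the two sides is [(a - m) * (a - m - 1)], a product of consecutive
    integers. This makes the pair count linear in [a]. *)
Lemma mul_le_bin2 m a : m * a <= 'C(a, 2) + 'C(m.+1, 2).
Proof.
rewrite -(leq_pmul2l (isT : 0 < 2)) mulnDr -!mul_bin_diag !bin1 /=.
case: a => [|a] /=; first by lia.
have [/subnK <-|/ltnW /subnK <-] := leqP m a; nia.
Qed.

Definition count_in (P : pred nat) l r := \sum_(l <= s < r | P s) 1.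

(** Pairs are sorted by their larger element [s']. *)
Lemma bin2_count_in P l r :
  'C(count_in P l r, 2) = \sum_(l <= s' < r | P s') count_in P l s'.
Proof.
have [lr|rl] := leqP l r; last first.
  by rewrite /count_in !big_geq ?(ltnW rl).
rewrite -(subnKC lr); elim: (r - l) => [|n IH].
  by rewrite addn0 /count_in !big_geq.
rewrite addnS big_mkcond big_nat_recr ?leq_addr //= -big_mkcond -IH.
rewrite {1}/count_in big_mkcond big_nat_recr ?leq_addr //= -big_mkcond.
rewrite -/(count_in _ _ _).
by case: (P _); rewrite ?addn0 // addn1 binS bin1.
Qed.

Lemma big_nat_ord_widen (P : pred nat) M l r (F : nat -> nat) : r <= M ->
  \sum_(l <= s < r | P s) F s = \sum_(s < M | P s && (l <= s < r)) F s.
Proof.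
move=> rM; rewrite (big_nat_widen _ _ M) // (big_nat_widenl _ 0) // big_mkord.
by apply: eq_bigl => s; rewrite -andbA; congr (_ && _); rewrite andbC.
Qed.

Section WindowInequality.
Variables (P : pred nat) (M : nat).
Hypothesis dP : distinct_differences P.

Let pairs : {set 'I_M * 'I_M} :=
  [set p : 'I_M * 'I_M | [&& p.1 < p.2, P p.1 & P p.2]].

Lemma bin2_count_in_pairs l r : r <= M ->
  'C(count_in P l r, 2) = \sum_(p in pairs) ((l <= p.1) && (p.2 < r) : nat).
Proof.
move=> rM; rewrite bin2_count_in (big_nat_ord_widen _ _ _ rM).
rewrite big_mkcond [RHS]big_mkcond /=.
transitivity (\sum_(s < M) \sum_(s' < M)
    if (s, s') \in pairs then ((l <= s) && (s' < r) : nat) else 0); last first.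
  by rewrite pair_bigA; apply: eq_bigr => -[].
rewrite exchange_big /=.
apply: eq_bigr => s' _; case: ifP => [/and3P[Ps' ls' s'r]|H].
  rewrite /count_in (@big_nat_ord_widen _ M) ?(ltnW (ltn_ord s')) // big_mkcond.
  apply: eq_bigr => s _; rewrite inE /= Ps' s'r !andbT.
  by case: (P s); case: (l <= s); case: (s < s').
rewrite big1 // => s _; case: ifP => // /[!inE] /= /and3P[ss' _ Ps'].
case: andP => // -[ls s'r]; move: H.
by rewrite Ps' s'r (leq_trans ls (ltnW ss')).
Qed.

(** A pair is determined by its difference, so each [d] is used at most once. *)
Lemma sum_pairs_le (k : nat -> nat) :
  \sum_(p in pairs) k (p.2 - p.1) <= \sum_(1 <= d < M) k d.
Proof.
(* The default [p.1] is never taken, as the difference is below [M]. *)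
pose h (p : 'I_M * 'I_M) : 'I_M := insubd p.1 (p.2 - p.1).
have hE p : h p = p.2 - p.1 :> nat.
  by rewrite val_insubd (leq_ltn_trans (leq_subr _ _) (ltn_ord _)).
have h_inj : {in pairs &, injective h}.
  move=> [s s'] [t t']; rewrite !inE /= => /and3P[ss' Ps Ps'] /and3P[tt' Pt Pt'].
  move/(congr1 val); rewrite /= !hE /= => e.
  by have [/val_inj -> /val_inj ->] := dP Ps Ps' Pt Pt' ss' tt' e.
under eq_bigr do rewrite -hE.
rewrite -(big_imset (fun d : 'I_M => k d) h_inj) /= (big_nat_ord_widen _ _ _ (leqnn M)).
rewrite big_mkcond [leqRHS]big_mkcond; apply: leq_sum => d _.
case: imsetP => [[p] |//]; rewrite inE => /andP[pp _] ->.
by rewrite ltn_ord hE subn_gt0 pp.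
Qed.

(** Apply [mul_le_bin2] in each window, then exchange the sums over windows and pairs: [k] dominates
    the total weight that a pair receives. *)
Lemma window_inequality (I : Type) (W : seq I) (l r m c : I -> nat) (k : nat -> nat) :
  (forall w, r w <= M) ->
  (forall s s', s < s' < M ->
    \sum_(w <- W | (l w <= s) && (s' < r w)) c w <= k (s' - s)) ->
  \sum_(w <- W) c w * (m w * count_in P (l w) (r w)) <=
  \sum_(1 <= d < M) k d + \sum_(w <- W) c w * 'C((m w).+1, 2).
Proof.
move=> rM kP.
apply: (@leq_trans (\sum_(w <- W)
    (c w * 'C(count_in P (l w) (r w), 2) + c w * 'C((m w).+1, 2)))).
  by apply: leq_sum => w _; rewrite -mulnDr leq_mul2l mul_le_bin2 orbT.
rewrite big_split leq_add2r /=; apply: leq_trans (sum_pairs_le k).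
under eq_bigr do rewrite bin2_count_in_pairs // big_distrr.
rewrite exchange_big; apply: leq_sum => -[s s']; rewrite inE /= => /and3P[ss' _ _].
apply: leq_trans (kP s s' _); last by rewrite ss' ltn_ord.
rewrite [leqRHS]big_mkcond; apply: leq_sum => w _ /=.
by case: ifP; rewrite ?muln1 ?muln0.
Qed.
End WindowInequality.

(** * Sliding windows of a fixed length *)

Lemma sum_nat_between a b l r :
  \sum_(a <= i < b | l <= i < r) 1 = minn b r - maxn a l.
Proof.
have [ab|/ltnW ba] := leqP a b; last by rewrite big_geq; lia.
rewrite -(subnKC ab); elim: (b - a) => [|n IH]; first by rewrite big_geq; lia.
rewrite addnS big_mkcond big_nat_recr ?leq_addr //= -big_mkcond IH.
by case: ifP; lia.
Qed.

Lemma sum_rev_ord n : \sum_(d < n) (n - d) = 'C(n.+1, 2).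
Proof.
elim: n => [|n IH]; first by rewrite big_ord0.
by rewrite big_ord_recl /= binS bin1 -IH addnC.
Qed.

(* Weight 1 on the windows of length [L.+1] that meet [1, x]: each element lies
   in [L.+1] of them, and each pair at distance [d] in [L.+1 - d]. *)
Lemma sliding_window_bound (P : pred nat) (m L x : nat) :
  distinct_differences P ->
  m * L.+1 * count_in P 1 x.+1 <= 'C(L.+1, 2) + (x + L) * 'C(m.+1, 2).
Proof.
move=> dP.
pose Q : pred nat := fun s => P s && (1 <= s < x.+1).
have dQ : distinct_differences Q.
  by move=> s s' t t' /andP[Ps _] /andP[Ps' _] /andP[Pt _] /andP[Pt' _]; exact: dP.
have mM i : minn i.+1 (L.+1 + x) <= L.+1 + x by exact: geq_minr.
(* Windows are indexed by their last element [i]. The cap on the right end is inactive for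
   [i <= x + L]; it only secures the bound required for every index. *)
have := @window_inequality Q _ dQ _ (index_iota 1 (x + L).+1)
  (fun i => i.+1 - L.+1) (fun i => minn i.+1 (L.+1 + x)) (fun=> m) (fun=> 1)
  (fun d => L.+1 - d) mM.
have -> : \sum_(1 <= d < L.+1 + x) (L.+1 - d) = 'C(L.+1, 2).
  rewrite addSn big_add1 /= big_mkord big_split_ord /= [X in _ + X]big1 ?addn0.
    by rewrite -sum_rev_ord.
  by move=> i _; rewrite subSS subnDA subnn.
have -> : \sum_(1 <= i < (x + L).+1) 1 * 'C(m.+1, 2) = (x + L) * 'C(m.+1, 2).
  by rewrite sum_nat_const_nat subn1 mul1n.
have kP s s' : s < s' < L.+1 + x ->
    \sum_(1 <= i < (x + L).+1 |
      (i.+1 - L.+1 <= s) && (s' < minn i.+1 (L.+1 + x))) 1 <= L.+1 - (s' - s).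
  move=> /andP[ss' s'M].
  rewrite (eq_bigl (fun i => s' <= i < (s + L).+1)) => [|i]; last first.
    rewrite leq_min s'M andbT ltnS leq_subLR andbC addnC.
    by congr (_ && _); lia.
  by rewrite sum_nat_between; lia.
move=> /(_ kP); apply: leq_trans.
under eq_bigr => i _ do
  rewrite mul1n /count_in (big_nat_ord_widen _ _ _ (mM i)) big_mkcond big_distrr /=.
rewrite exchange_big /= /count_in (@big_nat_ord_widen _ (L.+1 + x)) ?leq_addl //; last lia.
rewrite big_mkcond big_distrr /=; apply: leq_sum => s _.
case: ifP => [/andP[Ps sx]|]; last by rewrite muln0.
rewrite -big_distrr /= -mulnA leq_mul2l; apply/orP; right.
rewrite -big_mkcond (eq_bigl (fun i => s <= i < (s + L).+1)) => [|i]; last first.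
  rewrite /Q Ps sx /= leq_min leq_subLR andbC ltnS; move: sx; lia.
by rewrite sum_nat_between; lia.
Qed.

(** * Computable bounds from weighted windows *)

(* The interval [wl, wr) with the parameter m and the weight c of
   [window_inequality].  Weights are binary, so that the bound can be evaluated
   by the kernel. *)
Record window := Window { wl : nat; wr : nat; wm : nat; wc : N }.

Definition sumN (T : Type) (f : T -> N) (s : seq T) : N :=
  foldr (fun x => N.add (f x)) 0%num s.

Definition coverage W s :=
  sumN (fun w => wc w * N.of_nat (wm w))%num [seq w <- W | wl w <= s < wr w].

Definition pair_weight W s s' := sumN wc [seq w <- W | (wl w <= s) && (s' < wr w)].

(** Windows too short to contain a pair at distance [d] are discarded first, which lightens the
    evaluation. *)
Definition max_pair_weight W M d :=
  let Wd := [seq w <- W | wl w + d < wr w] in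
  foldr (fun s => N.max (pair_weight Wd s (s + d))) 0%num (iota 0 M).

(* The last sum (with truncated subtraction) pays for the positions where the
   windows do not reach the target [t], using that the indicator function is at
   most 1. *)
Definition certified_bound W M (t : nat -> N) :=
  (sumN (max_pair_weight W M) (iota 1 M.-1)
   + sumN (fun w => wc w * N.of_nat 'C((wm w).+1, 2)) W
   + sumN (fun s => t s - coverage W s) (iota 1 M.-1))%num.

Lemma to_nat_sumN (T : Type) (f : T -> N) (s : seq T) :
  N.to_nat (sumN f s) = \sum_(x <- s) N.to_nat (f x).
Proof. by elim: s => [|x s IH]; rewrite ?big_nil // big_cons -IH /=; lia. Qed.

Lemma to_nat_pair_weight W s s' :
  N.to_nat (pair_weight W s s') =
  \sum_(w <- W | (wl w <= s) && (s' < wr w)) N.to_nat (wc w).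
Proof. by rewrite to_nat_sumN big_filter. Qed.

Lemma max_pair_weightP W M s s' : s < s' < M ->
  \sum_(w <- W | (wl w <= s) && (s' < wr w)) N.to_nat (wc w)
    <= N.to_nat (max_pair_weight W M (s' - s)).
Proof.
move=> /andP[ss' s'M]; rewrite /max_pair_weight.
set V := [seq w <- W | _].
have -> : \sum_(w <- W | (wl w <= s) && (s' < wr w)) N.to_nat (wc w) =
    N.to_nat (pair_weight V s (s + (s' - s))).
  rewrite to_nat_pair_weight big_filter_cond subnKC ?(ltnW ss') //.
  by apply: eq_bigl => w; lia.
have : s \in iota 0 M by rewrite mem_iota; lia.
elim: (iota 0 M) => //= t r IH; rewrite inE => /orP[/eqP <-|/IH]; lia.
Qed.

Lemma certified_boundP (P : pred nat) W M (t : nat -> N) :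
  distinct_differences P ->
  \sum_(1 <= s < M | P s) N.to_nat (t s) <= N.to_nat (certified_bound W M t).
Proof.
move=> dP; set d := fun s => (t s - coverage W s)%num.
have -> : N.to_nat (certified_bound W M t) =
    \sum_(1 <= k < M) N.to_nat (max_pair_weight W M k)
    + \sum_(w <- W) N.to_nat (wc w) * 'C((wm w).+1, 2)
    + \sum_(1 <= s < M) N.to_nat (d s).
  rewrite !N2Nat.inj_add !to_nat_sumN /index_iota subn1; congr (_ + _ + _).
  by apply: eq_bigr => w _; rewrite N2Nat.inj_mul Nat2N.id.
apply: (@leq_trans (\sum_(1 <= s < M | P s) N.to_nat (coverage W s)
    + \sum_(1 <= s < M) N.to_nat (d s))).
  rewrite [X in _ <= _ + X](bigID P) /= addnA -big_split /=.
  by apply: leq_trans (leq_addr _ _); apply: leq_sum => s _; rewrite /d; lia.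
rewrite leq_add2r.
(* Cutting the windows at [M] changes nothing for elements and pairs below [M]. *)
pose r w := minn (wr w) M; have rM w : r w <= M by exact: geq_minr.
have kP s s' : s < s' < M ->
    \sum_(w <- W | (wl w <= s) && (s' < r w)) N.to_nat (wc w)
      <= N.to_nat (max_pair_weight W M (s' - s)).
  move=> /[dup] /andP[_ s'M] H; apply: leq_trans (max_pair_weightP W H).
  rewrite (eq_bigl (fun w => (wl w <= s) && (s' < wr w))) // => w.
  by rewrite leq_min s'M andbT.
apply: leq_trans (window_inequality dP wm rM kP).
under [leqRHS]eq_bigr => w _ do
  rewrite /count_in (big_nat_ord_widen _ _ _ (rM w)) big_mkcond !big_distrr /=.
rewrite exchange_big /= (big_nat_ord_widen _ _ _ (leqnn M)) big_mkcond.
apply: leq_sum => s _; case: ifP => // /andP[Ps _].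
rewrite to_nat_sumN big_filter big_mkcond; apply: leq_sum => w _.
rewrite Ps leq_min ltn_ord andbT; case: ifP => // _.
by rewrite N2Nat.inj_mul Nat2N.id muln1.
Qed.

(** * Square-root bound on the counting function and Abel summation *)

Local Open Scope ring_scope.

Lemma count_in_le_sqrt (R : realType) (P : pred nat) (x : nat) :
  distinct_differences P ->
  (count_in P 1 x.+1)%:R <= 28 / 25 * Num.sqrt (x%:R : R) + 19 / 8.
Proof.
move=> dP; set r : R := Num.sqrt x%:R.
have r0 : 0 <= r by exact: sqrtr_ge0.
have r2 : r ^+ 2 = x%:R by rewrite sqr_sqrtr.
(* 9/2 approximates the optimal ratio sqrt 20 of the window length to sqrt x *)
have /truncn_itv/andP[Lr rL] : 0 <= 9 / 2 * r by lra.
set L := Num.truncn _ in Lr rL.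
(* Dividing by [8 * L.+1] bounds the count by [L / 8 + 5 / 2 * (x + L) / (L + 1)]. At
   [L + 1 = 9 / 2 * r] this is at most [(9 / 16 + 5 / 9) * r + 5 / 2 - 1 / 8], whence [28 / 25] and
   [19 / 8]. *)
have : (8 * (L.+1 * count_in P 1 x.+1) <= L.+1 * L + 20 * (x + L))%N.
  have := sliding_window_bound 4 L x dP.
  by have := mul_bin_diag L.+1 1; rewrite bin1 /= (_ : 'C(5, 2) = 10%N) //; nia.
rewrite -(ler_nat R) !(natrM, natrD) -r2.
move: (count_in P 1 x.+1)%:R => A H.
have L1 : L.+1%:R = L%:R + 1 :> R by rewrite -natr1.
move: Lr rL H; rewrite L1; move: (L%:R : R) => l lr rl H.
rewrite -(ler_pM2l (_ : 0 < 8 * (l + 1))); last by lra.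
nra.
Qed.

Section Abel.
Variables (R : realType) (P : pred nat).
Hypothesis dP : distinct_differences P.

Let A x : R := (count_in P 1 x.+1)%:R.
Let f x : R := \sum_(1 <= s < x.+1 | P s) s%:R^-1.
(** A potential for the Abel tail, the sum of [A y * (1 / y - 1 / (y + 1))] over [y >= x]: the first
    term is the integral of [28 / 25 * y ^ (-3/2)] from [x] on, the second telescopes. *)
Let Phi x : R := 2 * (28 / 25) / Num.sqrt x%:R + 19 / 8 / x%:R.

Let AS x : A x.+1 = A x + (P x.+1)%:R.
Proof.
rewrite /A /count_in big_mkcond big_nat_recr //= -big_mkcond natrD.
by case: (P _).
Qed.

Let fS x : f x.+1 = f x + (P x.+1)%:R / x.+1%:R.
Proof.
rewrite /f big_mkcond big_nat_recr //= -big_mkcond.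
by case: (P _); rewrite ?mul1r ?mul0r.
Qed.

Lemma abel_potential_step x : (0 < x)%N -> A x / x%:R - A x / x.+1%:R <= Phi x - Phi x.+1.
Proof.
move=> x0.
have := @count_in_le_sqrt R _ x dP; rewrite -/(A x) /Phi.
set r := Num.sqrt x%:R; set q := Num.sqrt x.+1%:R.
have r0 : 0 < r by rewrite sqrtr_gt0 ltr0n.
have q0 : 0 < q by rewrite sqrtr_gt0 ltr0n.
have r2 : x%:R = r ^+ 2 by rewrite sqr_sqrtr.
have q2 : x.+1%:R = q ^+ 2 by rewrite sqr_sqrtr.
have qr : q ^+ 2 = r ^+ 2 + 1 by rewrite -r2 -q2 natr1.
rewrite q2 r2; move: (A x) => a H.
have -> : a / r ^+ 2 - a / q ^+ 2 = a * (r^-1 ^+ 2 * q^-1 ^+ 2).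
  have -> : a * (r^-1 ^+ 2 * q^-1 ^+ 2) =
      a * (q ^+ 2 - r ^+ 2) * (r^-1 ^+ 2 * q^-1 ^+ 2).
    by rewrite qr; ring.
  by field; rewrite !gt_eqF.
have -> : 2 * (28 / 25) / r + 19 / 8 / r ^+ 2 - (2 * (28 / 25) / q + 19 / 8 / q ^+ 2)
   = (28 / 25 * (2 * q * (q - r) * r) + 19 / 8 * (q ^+ 2 - r ^+ 2))
     * (r^-1 ^+ 2 * q^-1 ^+ 2).
  by field; rewrite !gt_eqF.
rewrite ler_pM2r; last by rewrite mulr_gt0 // exprn_gt0 // invr_gt0.
apply: le_trans H _; rewrite [q ^+ 2 - _](_ : _ = 1) ?mulr1; last by rewrite qr; ring.
rewrite lerD2r ler_pM2l //.
rewrite -[leLHS]mul1r ler_pM2r //.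
(* [2 * q * (q - r) = (q - r) ^ 2 + (q ^ 2 - r ^ 2) >= 1]. *)
have := sqr_ge0 (q - r); rewrite sqrrB qr; lra.
Qed.

Lemma partial_sum_le N X : (0 < N <= X)%N -> f X <= f N - A N / N%:R + Phi N.
Proof.
move=> /andP[N0 NX].
(* The quantity [f - A / x + Phi] does not increase with [x]: a new element adds the same amount to
   [f] and to [A / x]. *)
have H : f X - A X / X%:R + Phi X <= f N - A N / N%:R + Phi N.
  rewrite -(subnKC NX); elim: (X - N)%N => [|n IH]; first by rewrite addn0.
  apply: le_trans IH; rewrite addnS fS AS [(A _ + _) / _]mulrDl.
  have := @abel_potential_step (N + n) ltac:(by rewrite addn_gt0 N0).
  move: (Phi _.+1) (Phi _) (A _ / _.+1%:R) (A _ / _) (_ / _.+1%:R) (f _).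
  by move=> *; lra.
apply: le_trans H.
have X0 : 0 < X%:R :> R by rewrite ltr0n (leq_trans N0).
(* It remains to see that [A X / X <= Phi X]. *)
have := @count_in_le_sqrt R _ X dP; rewrite -/(A X) /Phi.
have r0 : 0 < Num.sqrt X%:R :> R by rewrite sqrtr_gt0.
have r2 : X%:R = Num.sqrt X%:R ^+ 2 :> R by rewrite sqr_sqrtr // ltW.
rewrite r2 sqrtr_sqr gtr0_norm //; move: (Num.sqrt _) r0 => r r0 H.
have : A X / r ^+ 2 <= (28 / 25 * r + 19 / 8) / r ^+ 2.
  by rewrite ler_pM2r ?invr_gt0 ?exprn_gt0.
have -> : (28 / 25 * r + 19 / 8) / r ^+ 2 = 28 / 25 / r + 19 / 8 / r ^+ 2.
  by field; rewrite gt_eqF.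
have : 0 < r^-1 by rewrite invr_gt0.
lra.
Qed.
End Abel.

(** * The numerical certificate for the elements up to 81 *)

(* A rounded and sparsified dual solution of the linear program; the unit of
   weight is 1/50000. *)
Definition certificate := [::
  Window 1 3 1 8336; Window 1 5 2 1512; Window 1 6 3 625; Window 1 7 3 103;
  Window 1 9 3 158; Window 1 10 3 103; Window 1 11 4 140; Window 1 12 4 43;
  Window 1 13 4 72; Window 1 14 4 72; Window 1 15 4 83; Window 1 17 4 71;
  Window 1 19 5 12; Window 2 4 1 6592; Window 2 7 2 522; Window 2 12 3 15;
  Window 2 13 3 16; Window 2 16 3 60; Window 2 20 4 12; Window 3 18 3 71;
  Window 4 8 1 1512; Window 4 9 1 364; Window 4 12 2 69; Window 4 14 2 32;
  Window 4 15 2 18; Window 4 20 3 45; Window 4 22 3 26; Window 5 10 1 358;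
  Window 5 11 1 39; Window 5 19 2 64; Window 6 12 1 150; Window 6 20 2 29;
  Window 7 13 1 220; Window 7 21 2 56; Window 8 16 1 121; Window 8 18 1 47;
  Window 8 22 2 60; Window 8 23 2 37; Window 8 24 2 43; Window 9 19 1 28;
  Window 9 20 1 15; Window 9 25 2 25; Window 9 27 2 26; Window 10 21 1 111;
  Window 11 24 1 31; Window 11 27 2 57; Window 12 25 1 125;
  Window 13 23 1 80; Window 13 29 2 52; Window 13 31 2 26; Window 14 27 1 77;
  Window 15 25 1 48; Window 15 29 1 49; Window 15 33 2 18; Window 16 29 1 94;
  Window 17 27 1 36; Window 17 33 1 64; Window 18 31 1 96; Window 19 31 1 71;
  Window 20 33 1 61; Window 20 35 1 64; Window 21 33 1 18; Window 21 35 1 86;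
  Window 22 37 1 88; Window 23 37 1 58; Window 24 41 1 26;
  Window 25 39 1 129; Window 25 41 1 10; Window 27 41 1 84;
  Window 27 43 1 46; Window 29 43 1 64; Window 29 45 1 55; Window 31 45 1 24;
  Window 31 47 1 83; Window 33 49 1 82; Window 35 51 1 65; Window 37 53 1 66;
  Window 39 55 1 34; Window 39 57 1 26; Window 41 57 1 32; Window 41 59 1 25;
  Window 43 59 1 30; Window 43 61 1 26; Window 45 63 1 26; Window 47 63 1 28;
  Window 47 65 1 25; Window 49 67 1 25; Window 51 69 1 25; Window 53 71 1 25;
  Window 57 74 1 26; Window 59 77 1 26; Window 63 80 1 25; Window 65 82 1 10].

(* 50000 (1/s - 1/81), rounded up *)
Definition target s :=
  let n := N.of_nat s in ((50000 * (81 - n) + (81 * n - 1)) / (81 * n))%num.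

Lemma targetP s : (1 <= s < 82)%N ->
  (50000 * (81 - N.of_nat s) <= target s * (81 * N.of_nat s))%num.
Proof.
move=> s82.
have : all (fun s => let n := N.of_nat s in
    50000 * (81 - n) <=? target s * (81 * n))%num (iota 1 81).
  by vm_compute.
by move=> /allP/(_ s); rewrite mem_iota => /(_ s82)/N.leb_le.
Qed.

Lemma certified_bound_le :
  (1000 * certified_bound certificate 82 target <= 1969 * 50000)%num.
Proof. by apply/N.leb_le; vm_compute. Qed.

Lemma head_sum_le (R : realType) (P : pred nat) : distinct_differences P ->
  \sum_(1 <= s < 82 | P s) (s%:R^-1 : R) - (count_in P 1 82)%:R / 81 <= 1969 / 1000.
Proof.
move=> dP; have := certified_boundP certificate 82 target dP.
have := certified_bound_le.
move: (certified_bound _ _ _) => B HB HP.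
(* The unit stays abstract, so that no large unary numeral is built. *)
set Q : R := (N.to_nat 50000)%:R.
have Q0 : 0 < Q by rewrite ltr0n; lia.
have {HB} HB : 1000 * (N.to_nat B)%:R <= 1969 * Q.
  by rewrite /Q -!natrM ler_nat; lia.
rewrite -(ler_pM2l Q0); apply: (@le_trans _ _ (N.to_nat B)%:R); last by lra.
apply: le_trans (_ : (\sum_(1 <= s < 82 | P s) N.to_nat (target s))%:R <= _);
  last by rewrite ler_nat.
rewrite /count_in !natr_sum mulr_suml -sumrB mulr_sumr.
rewrite [leLHS]big_nat_cond [leRHS]big_nat_cond; apply: ler_sum => s /andP[s82 _].
have s0 : 0 < s%:R :> R by rewrite ltr0n; lia.
have H : Q * (81 - s%:R) <= (N.to_nat (target s))%:R * (81 * s%:R).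
  rewrite /Q -natrB; last by lia.
  by rewrite -!natrM ler_nat; have := targetP s82; lia.
have -> : Q * (s%:R^-1 - 1%:R / 81) = Q * (81 - s%:R) / (81 * s%:R).
  by field; rewrite gt_eqF.
by rewrite ler_pdivrMr // mulr_gt0.
Qed.

(** * From finite sums to the supremum *)

Lemma finite_sum_le (R : realType) (P : pred nat) (X : nat) :
  distinct_differences P ->
  \sum_(1 <= s < X.+1 | P s) (s%:R^-1 : R) <= 2 + 247 / 10 ^+ 3 + 307 / 10 ^+ 6.
Proof.
move=> dP.
(* Lengthening the range lets the Abel bound start at 81 even when [X] is smaller. *)
apply: (@le_trans _ _ (\sum_(1 <= s < (X + 81).+1 | P s) (s%:R^-1 : R))).
  rewrite -addSn [leRHS]big_mkcond [leRHS](@big_cat_nat _ _ _ X.+1) //= ?leq_addr //.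
  rewrite -big_mkcond lerDl; apply: sumr_ge0 => s _.
  by case: ifP => _; rewrite ?invr_ge0.
have X81 : (0 < 81 <= X + 81)%N by rewrite leq_addl.
have := partial_sum_le R dP X81.
have -> : Num.sqrt 81%:R = 9 :> R.
  by rewrite (_ : 81%:R = 9 ^+ 2) ?sqrtr_sqr ?ger0_norm //; ring.
(* [1.969 + 2.24 / 9 + 19 / 648 < 2.24722]. *)
have := head_sum_le R dP; lra.
Qed.

(* 2.247307, split into groups of three decimals because numerals of a ring
   are unary *)
Theorem theorem5p1 (R : realType) :
  (DDC R <= (2 + 247 / 10 ^+ 3 + 307 / 10 ^+ 6 : R)%:E)%E.
Proof.
(* The extended sum over [S] is itself the supremum of the sums over finite subsets [A]. *)
apply: ge_ereal_sup => _ [S sS <-]; apply: ge_ereal_sup => _ [A [finA AS] <-].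
set F := finite_support _ _ _.
have FS s : s \in F -> S s.
  rewrite in_finite_support; last exact: sub_finite_set finA.
  by rewrite inE => -[/AS].
have dF := sidon_distinct_differences sS FS.
rewrite sumEFin lee_fin.
have -> : \sum_(s <- F) (s%:R^-1 : R) =
    \sum_(1 <= s < (\max_(s <- F) s).+1 | s \in F) s%:R^-1.
  rewrite -[RHS]big_filter; apply: perm_big; apply: uniq_perm.
  - exact: finite_support_uniq.
  - by rewrite filter_uniq ?iota_uniq.
  move=> s; rewrite mem_filter mem_index_iota; case sF: (s \in F) => //=.
  by rewrite ltnS leq_bigmax_seq // (sS.1 _ (FS _ sF)).
exact: finite_sum_le.
Qed.
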